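(* Let $\langle A,R\rangle$ and $\langle B,S\rangle$ be sets with binary relations on them. Let $T$ be the relation on the cartesian product $A\times B$ defined by $\langle a,b\rangle\, T\,\langle a',b'\rangle$ iff $a\,R\,a'$ and $b\,S\,b'$. Then $\langle A\times B,T\rangle$, together with the projections $\pi_A:A\times B\to A$ and $\pi_B:A\times B\to B$, is a product of $\langle A,R\rangle$ and $\langle B,S\rangle$ in the category $\mathsf{EndoRel}$.
   Context: $\mathsf{EndoRel}$ is the category whose objects are pairs $\langle A,R\rangle$ with $A$ a set and $R\subseteq A\times A$ an arbitrary binary relation on $A$, and whose morphisms $f:\langle A,R\rangle\to\langle B,S\rangle$ are the functions $f:A\to B$ such that $\langle a,a'\rangle\in R$ implies $\langle f(a),f(a')\rangle\in S$ for all $a,a'\in A$. *)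

(* Defs.v *)
From Stdlib Require Import Relations.Relation_Definitions.

Set Implicit Arguments.
Unset Strict Implicit.

Record category := Category {
  obj :> Type;
  hom : obj -> obj -> Type;
  idm : forall X, hom X X;
  comp : forall X Y Z, hom Y Z -> hom X Y -> hom X Z;
  comp_idl : forall X Y (f : hom X Y), comp (idm Y) f = f;
  comp_idr : forall X Y (f : hom X Y), comp f (idm X) = f;
  comp_assoc : forall W X Y Z (h : hom Y Z) (g : hom X Y) (f : hom W X),
    comp h (comp g f) = comp (comp h g) f
}.

Definition is_product (C : category) (X Y P : C) (p : hom P X) (q : hom P Y)
    : Prop :=
  forall (Z : C) (f : hom Z X) (g : hom Z Y),
    exists! h : hom Z P, comp p h = f /\ comp q h = g.

Record endorel := EndoRelObj {
  carrier : Type;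
  rel : relation carrier
}.
Arguments rel : clear implicits.

Definition preserves_rel (A B : Type) (R : relation A) (S : relation B)
    (f : A -> B) : Prop :=
  forall a a' : A, R a a' -> S (f a) (f a').

Record endorel_hom (X Y : endorel) := EndoRelHom {
  hom_fun : carrier X -> carrier Y;
  hom_preserves : preserves_rel (rel X) (rel Y) hom_fun
}.

Definition endorel_id (X : endorel) : endorel_hom X X :=
  @EndoRelHom X X (fun a => a) (fun a a' r => r).

Definition endorel_comp (X Y Z : endorel)
    (g : endorel_hom Y Z) (f : endorel_hom X Y) : endorel_hom X Z :=
  @EndoRelHom X Z (fun a => hom_fun g (hom_fun f a))
    (fun a a' r => hom_preserves g (hom_preserves f r)).

Lemma endorel_comp_idl X Y (f : endorel_hom X Y) :
  endorel_comp (endorel_id Y) f = f.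
Proof. destruct f; reflexivity. Qed.

Lemma endorel_comp_idr X Y (f : endorel_hom X Y) :
  endorel_comp f (endorel_id X) = f.
Proof. destruct f; reflexivity. Qed.

Lemma endorel_comp_assoc W X Y Z
    (h : endorel_hom Y Z) (g : endorel_hom X Y) (f : endorel_hom W X) :
  endorel_comp h (endorel_comp g f) = endorel_comp (endorel_comp h g) f.
Proof. reflexivity. Qed.

Definition EndoRel : category :=
  Category endorel_comp_idl endorel_comp_idr endorel_comp_assoc.

Definition product_rel (A B : Type) (R : relation A) (S : relation B)
    : relation (A * B) :=
  fun x y => R (fst x) (fst y) /\ S (snd x) (snd y).

(* Main.v *)
Require Import Defs.
From Stdlib Require Import Relations.Relation_Definitions.
From Stdlib Require Import ProofIrrelevance FunctionalExtensionality.

(** The set-theoretic pairing of [f] and [g] is the only possible mediating function, and since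
    [product_rel] is a componentwise conjunction, it preserves relations exactly because both
    components do. *)

(** Once the underlying functions are identified, the preservation proofs agree by proof
    irrelevance. *)
Lemma endorel_hom_ext (X Y : endorel) (f g : endorel_hom X Y) :
  (forall a, hom_fun f a = hom_fun g a) -> f = g.
Proof.
  destruct f as [f hf], g as [g hg]; simpl; intros e.
  apply functional_extensionality in e; subst g.
  f_equal; apply proof_irrelevance.
Qed.

Theorem mainTheorem4 (A B : Type) (R : relation A) (S : relation B) :
  exists (hA : preserves_rel (product_rel R S) R (fun x : A * B => fst x))
         (hB : preserves_rel (product_rel R S) S (fun x : A * B => snd x)),
    @is_product EndoRel
      (EndoRelObj R) (EndoRelObj S) (EndoRelObj (product_rel R S))
      (@EndoRelHom (EndoRelObj (product_rel R S)) (EndoRelObj R)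
         (fun x : A * B => fst x) hA)
      (@EndoRelHom (EndoRelObj (product_rel R S)) (EndoRelObj S)
         (fun x : A * B => snd x) hB).
Proof.
  exists (fun x y r => proj1 r), (fun x y r => proj2 r).
  intros Z f g.
  exists (@EndoRelHom Z (EndoRelObj (product_rel R S))
            (fun z => (hom_fun f z, hom_fun g z))
            (fun z z' r => conj (hom_preserves f r) (hom_preserves g r))).
  split.
  - split; apply endorel_hom_ext; reflexivity.
  (* Replacing [f] and [g] by the composites of [h] with the projections reduces uniqueness to
     surjective pairing at [h z]. *)
  - intros h [<- <-]; apply endorel_hom_ext; intros z; simpl.
    symmetry; apply surjective_pairing.
Qed.
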